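(* Let $X$ and $Y$ be continuous real random variables on a common probability space, each with distribution function strictly increasing where it takes values in $(0,1)$. Suppose $X$ and $Y$ are comonotone, i.e. there exists a strictly increasing function $g$ such that $\mathbb{P}[Y=g(X)]=1$. Then for every $0<\alpha<1$, $$\text{VaR}_{\alpha}(X+Y)=\text{VaR}_{\alpha}(X)+\text{VaR}_{\alpha}(Y).$$
   Context: For a real random variable $Z$, let $F_Z(z)=\mathbb{P}(Z\leq z)$ denote its distribution function; $Z$ is called continuous if $F_Z$ is continuous. For $0<\alpha<1$, Value at Risk of level $\alpha$ is $\text{VaR}_{\alpha}(Z):=F_Z^{-1}(\alpha)$, where $F_Z^{-1}$ is the quantile function of $Z$, $F_Z^{-1}(\alpha)=\inf\{z\in\mathbb{R}:F_Z(z)\geq\alpha\}$; when $F_Z$ is continuous and strictly increasing on $\{z:0<F_Z(z)<1\}$ this is the ordinary inverse, i.e. the unique $z$ with $F_Z(z)=\alpha$. The function $g$ in the definition of comonotonicity is real-valued and defined on (a subset of $\mathbb{R}$ containing) the range of $X$. *)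

(* Defs.v *)
From HB Require Import structures.
From mathcomp Require Import all_boot all_order all_algebra.
From mathcomp Require Import all_classical all_reals all_analysis.
From mathcomp Require Import measurable_realfun.

Set Implicit Arguments.
Unset Strict Implicit.
Unset Printing Implicit Defensive.
Import Order.TTheory GRing.Theory Num.Theory numFieldNormedType.Exports.

Local Open Scope classical_set_scope.
Local Open Scope ring_scope.

Definition continuous_rv (d : measure_display) (T : measurableType d)
    (R : realType) (P : probability T R) (X : {RV P >-> R}) : Prop :=
  continuous (cdf X).

Definition cdf_strictly_increasing (d : measure_display)
    (T : measurableType d) (R : realType) (P : probability T R)
    (X : {RV P >-> R}) : Prop :=
  {in [set z : R | (0 < cdf X z < 1)%E] &,
    {homo cdf X : y z / y < z >-> (y < z)%E}}.

(* [inf] is real-valued and returns 0 on sets without an infimum; for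
   0 < alpha < 1 the set below is nonempty and bounded from below. *)
Definition quantile (d : measure_display) (T : measurableType d)
    (R : realType) (P : probability T R) (X : {RV P >-> R}) (alpha : R) : R :=
  inf [set z : R | (alpha%:E <= cdf X z)%E].

Definition VaR (d : measure_display) (T : measurableType d)
    (R : realType) (P : probability T R) (alpha : R) (X : {RV P >-> R}) : R :=
  quantile X alpha.

(* D is the domain of g; the values of g outside D are irrelevant.  Since g is
   monotone on D and X takes its values in D, the event is measurable. *)
Definition comonotone (d : measure_display) (T : measurableType d)
    (R : realType) (P : probability T R) (X Y : {RV P >-> R}) : Prop :=
  exists (D : set R) (g : R -> R),
    [/\ range X `<=` D,
        {in D &, {homo g : x y / x < y}} &
        P [set w | Y w = g (X w)] = 1%E].

(* Main.v *)
(* Off a null event, the outcomes are ordered the same way by X and by Y, so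
   that of two events {X <= x} and {Y <= y} one is contained in the other.
   Taking x and y to be the quantiles, the smaller event lies in
   {X + Y <= x + y}, which bounds the quantile of the sum from above; taking x
   and y just below the quantiles, the larger event contains
   {X + Y <= x + y}, which bounds it from below. *)
Require Import Defs.
From HB Require Import structures.
From mathcomp Require Import all_boot all_order all_algebra.
From mathcomp Require Import all_classical all_reals all_analysis.
From mathcomp Require Import measurable_realfun.
From mathcomp Require Import ring lra.

Set Implicit Arguments.
Unset Strict Implicit.
Unset Printing Implicit Defensive.
Import Order.TTheory GRing.Theory Num.Theory numFieldNormedType.Exports.

Local Open Scope classical_set_scope.
Local Open Scope ring_scope.

(** Needed to make [Y = g(X)] an event: [D] is an arbitrary set and [g] is arbitrary off [D], so
    measurability must come from monotonicity on [D]. *)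
Lemma measurable_fun_comp_increasing (d : measure_display)
    (T : measurableType d) (R : realType) (X : T -> R) (D : set R)
    (g : R -> R) :
  measurable_fun setT X -> range X `<=` D ->
  {in D &, {homo g : x y / x < y}} -> measurable_fun setT (g \o X).
Proof.
move=> mX XD gD; apply: (measurability (@RGenCInfty.G R)) => [|/= _ [_] [r] -> <-].
  exact: RGenCInfty.measurableE.
(* [J] is the upward closure, in the whole line, of the points of [D] where [g] is at least [r]. An
   up-set is an interval, hence Borel, whatever [D] is. *)
pose J := [set x | exists2 z, D z /\ r <= g z & z <= x].
suff -> : (g \o X) @^-1` `[r, +oo[ = X @^-1` J.
  apply: mX => //; apply: is_interval_measurable => s t [z zD zs] _ u /andP[su _].
  by exists z => //; exact: le_trans su.
apply/seteqP; split => w /=; rewrite in_itv/= andbT.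
  by move=> rgX; exists (X w) => //; split=> //; apply: XD; exists w.
move=> [z [Dz rgz] zX]; move: zX rgz; rewrite [z <= _]le_eqVlt => /predU1P[-> //|zX rgz].
apply/(le_trans rgz)/ltW/gD => //; rewrite inE //.
by apply: XD; exists w.
Qed.

Section random_variables.
Context (d : measure_display) (T : measurableType d) (R : realType)
  (P : probability T R).
Implicit Types X Y : {RV P >-> R}.

Lemma comonotone_ordered X Y : comonotone X Y ->
  exists E : set T, [/\ measurable E, P E = 1%E &
    forall w v, E w -> E v -> X w < X v -> Y w < Y v].
Proof.
move=> [D [g [XD gD PE]]]; exists [set w | Y w = g (X w)]; split=> //.
- have mgX : measurable_fun setT (g \o X).
    exact: (measurable_fun_comp_increasing _ XD gD).
  have := measurable_fun_eqr (measurable_funP Y) mgX measurableT (Y := [set true]).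
  rewrite setTI => /(_ I); congr measurable.
  by apply/seteqP; split => w /= /eqP.
- move=> w v -> -> Xwv; apply: gD => //; rewrite inE; apply: XD.
  + by exists w.
  + by exists v.
Qed.

Lemma le_cdf_as (E : set T) X Y x y : measurable E -> P E = 1%E ->
  (forall w, E w -> X w <= x -> Y w <= y) -> (cdf X x <= cdf Y y)%E.
Proof.
move=> mE PE XY.
have mX : measurable (X @^-1` `]-oo, x]) by exact: measurable_funPTI.
have mY : measurable (Y @^-1` `]-oo, y]) by exact: measurable_funPTI.
have mEC : measurable (~` E) by exact: measurableC.
apply: (@le_trans _ _ (P (Y @^-1` `]-oo, y] `|` ~` E))).
  apply: (le_measure P); rewrite ?inE//; first exact: measurableU.
  move=> w /=; rewrite !in_itv/= => Xx.
  by have [/XY/(_ Xx)|] := pselect (E w); [left|right].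
rewrite (le_trans (measureU2 _ _ _))//= probability_setC// PE subee//.
by rewrite adde0.
Qed.

(** One failure of the second inclusion forces the first: if [Y v <= y] and [x < X v], then
    [X w <= x < X v] gives [Y w < Y v <= y]. *)
Lemma comonotone_nested (E : set T) X Y x y :
  (forall w v, E w -> E v -> X w < X v -> Y w < Y v) ->
  (forall w, E w -> X w <= x -> Y w <= y) \/
  (forall w, E w -> Y w <= y -> X w <= x).
Proof.
move=> XY; have [|nxy] := pselect (forall w, E w -> X w <= x -> Y w <= y).
  by left.
right=> v Ev Yv; rewrite leNgt; apply/negP => xXv; apply: nxy => w Ew Xw.
by rewrite ltW// (lt_le_trans _ Yv)// XY// (le_lt_trans Xw).
Qed.

(** The limits 0 and 1 of the cdf make the infimum a genuine one, and right continuity makes it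
    attained. *)
Lemma le_quantile X (alpha z : R) : 0 < alpha < 1 ->
  (quantile X alpha <= z) = (alpha%:E <= cdf X z)%E.
Proof.
move=> /andP[a0 a1]; pose S := [set z | (alpha%:E <= cdf X z)%E].
have lbS u : (cdf X u < alpha%:E)%E -> lbound S u.
  move=> Xu s aXs; rewrite leNgt; apply/negP => /ltW su.
  by have := le_lt_trans (le_trans aXs (cdf_nondecreasing X su)) Xu; rewrite ltxx.
have nbhs_lt x : (x < alpha%:E)%E -> nbhs x [set y | (y < alpha%:E)%E].
  by move=> xa; apply: open_nbhs_nbhs; split=> //; exact: open_ereal_lt_ereal.
have [u Xu] : exists u, (cdf X u < alpha%:E)%E.
  have /nbhs_lt/(cvg_cdfNy0 X) : (0 < alpha%:E)%E by rewrite lte_fin.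
  exact: (@filter_ex _ -oo%R).
have S0 : S !=set0.
  have : nbhs 1%E [set y | (alpha%:E < y)%E].
    apply: open_nbhs_nbhs; split; first exact: open_ereal_gt_ereal.
    by rewrite /= lte_fin.
  by move=> /(cvg_cdfy1 X)/(@filter_ex _ +oo%R)[v /ltW]; exists v.
apply/idP/idP => [qz|az]; last by apply: ge_inf => //; exists u; exact: lbS.
apply: le_trans (cdf_nondecreasing X qz); rewrite leNgt; apply/negP => Xq.
(* Some [r] above the quantile still has cdf below [alpha], so [r] is a lower bound of [S] exceeding
   its infimum. *)
have [r [qr]] := filter_ex (filterI (nbhs_right_gt (quantile X alpha))
  (cdf_right_continuous (nbhs_lt _ Xq))).
by move=> /lbS/(lb_le_inf S0); rewrite leNgt qr.
Qed.

End random_variables.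

Theorem theorem5p1 (d : measure_display) (T : measurableType d)
    (R : realType) (P : probability T R) (X Y : {RV P >-> R})
    (cX : continuous_rv X) (cY : continuous_rv Y)
    (sX : cdf_strictly_increasing X) (sY : cdf_strictly_increasing Y)
    (coXY : comonotone X Y) (alpha : R) (alpha01 : 0 < alpha < 1) :
  VaR alpha (X + Y : {RV P >-> R}) = VaR alpha X + VaR alpha Y.
Proof.
have [E [mE PE XY]] := comonotone_ordered coXY.
rewrite /VaR; set a := quantile X alpha; set b := quantile Y alpha.
apply/le_anti/andP; split.
  have aX : (alpha%:E <= cdf X a)%E by rewrite -le_quantile.
  have bY : (alpha%:E <= cdf Y b)%E by rewrite -le_quantile.
  rewrite le_quantile//.
  have [XYab|YXab] := comonotone_nested a b XY.
    apply/(le_trans aX)/(le_cdf_as mE PE) => w Ew Xa /=.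
    by rewrite lerD// XYab.
  apply/(le_trans bY)/(le_cdf_as mE PE) => w Ew Yb /=.
  by rewrite lerD// YXab.
rewrite leNgt; apply/negP; set q := quantile _ _ => qab.
have qS : (alpha%:E <= cdf (X + Y : {RV P >-> R})%R q)%E by rewrite -le_quantile.
(* Half of the gap, so that [q] splits as a sum of two points strictly below the quantiles. *)
pose e := (a + b - q) / 2.
have e0 : 0 < e by rewrite divr_gt0// subr_gt0.
have qE : q = (a - e) + (b - e) by rewrite /e; field.
have [XYab|YXab] := comonotone_nested (a - e) (b - e) XY.
  (* On [E], [X + Y <= q] forces [Y <= b - e]: by the inclusion if [X <= a - e], by subtraction
     otherwise. So [b - e] already reaches level [alpha], which is absurd. *)
  have : b <= b - e.
    rewrite le_quantile// (le_trans qS)//; apply: (le_cdf_as mE PE) => w Ew XYq.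
    have [/XYab->//|Xa] := leP (X w) (a - e).
    have : X w + Y w <= q := XYq; rewrite qE; lra.
  lra.
have : a <= a - e.
  rewrite le_quantile// (le_trans qS)//; apply: (le_cdf_as mE PE) => w Ew XYq.
  have [/YXab->//|Yb] := leP (Y w) (b - e).
  have : X w + Y w <= q := XYq; rewrite qE; lra.
lra.
Qed.
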